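(* For $m=3$, the local observability condition fails for the loss matrix $L$ and the feedback matrix $H$ of the SumLoss game with top-1 feedback; that is, there is a pair of neighboring learner's actions which is not locally observable.
   Context: Items are numbered $1,\dots,m$. A permutation $\sigma$ maps ranks to items and $\sigma^{-1}$ maps items to ranks. The learner's actions are the $m!$ permutations $\sigma_1,\dots,\sigma_{m!}$; the adversary's actions are the $2^m$ binary relevance vectors $R_1,\dots,R_{2^m}\in\{0,1\}^m$. Loss matrix: $L\in\mathbb{R}^{m!\times 2^m}$, $L_{i,j}=\mathrm{SumLoss}(\sigma_i,R_j)=\sum_{k=1}^m\sigma_i^{-1}(k)R_j(k)$; $\ell_i$ is its $i$th row. Feedback matrix (top-1 feedback): $H_{i,j}=R_j(\sigma_i(1))$. Signal matrix of action $\sigma_i$: $S_i\in\{0,1\}^{2\times 2^m}$, $(S_i)_{1,\ell}=\mathbb{1}(H_{i,\ell}=0)$, $(S_i)_{2,\ell}=\mathbb{1}(H_{i,\ell}=1)$. Let $\Delta$ be the probability simplex in $\mathbb{R}^{2^m}$. Action $i$ is optimal under $p\in\Delta$ if $\ell_i\cdot p\le\ell_j\cdot p$ for all $j\neq i$; $C_i=\{p\in\Delta:\text{action }i\text{ is optimal under }p\}$; action $i$ is Pareto-optimal if $C_i$ is non-empty and $(2^m-1)$-dimensional. Two Pareto-optimal actions $i,j$ are neighboring if $C_i\cap C_j$ is a $(2^m-2)$-dimensional polytope; their neighborhood action set is $N^+_{i,j}=\{k\in[m!]: C_i\cap C_j\subseteq C_k\}$. A pair of neighboring actions $i,j$ is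 locally observable if $\ell_i-\ell_j\in\bigoplus_{k\in N^+_{i,j}}\mathrm{Col}(S_k^\top)$ (the linear span of the columns of these matrices). The local observability condition holds if every pair of neighboring actions is locally observable. *)

(* Defs.v *)
From HB Require Import structures.
From mathcomp Require Import all_boot all_order all_algebra all_fingroup.
From mathcomp Require Import boolp classical_sets reals.

Set Implicit Arguments.
Unset Strict Implicit.
Unset Printing Implicit Defensive.

Import Order.TTheory GRing.Theory Num.Theory.

Local Open Scope classical_set_scope.
Local Open Scope ring_scope.

Definition dot (R : realType) (n : nat) (u v : 'rV[R]_n) : R :=
  \sum_k u 0 k * v 0 k.

Definition simplex (R : realType) (n : nat) : set 'rV[R]_n :=
  [set p | (forall k, 0 <= p 0 k) /\ \sum_k p 0 k = 1].

Definition affine_hull (R : realType) (n : nat) (A : set 'rV[R]_n) :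
    set 'rV[R]_n :=
  [set y | exists q (x : 'I_q -> 'rV[R]_n) (a : 'I_q -> R),
     [/\ forall i, A (x i), \sum_i a i = 1 & y = \sum_i a i *: x i]].

(* The dimension of a set is that of its affine hull, a translate of the row
   space of some matrix U; has_dim A d entails that A is non-empty. *)
Definition has_dim (R : realType) (n : nat) (A : set 'rV[R]_n) (d : nat) :
    Prop :=
  exists (x0 : 'rV[R]_n) (U : 'M[R]_n),
    \rank U = d /\
    affine_hull A = [set y | exists2 u : 'rV[R]_n, (u <= U)%MS & y = x0 + u].

(* N is the number of the learner's actions, n the number of the adversary's. *)
Definition optimal (R : realType) (N n : nat) (L : 'M[R]_(N, n))
    (i : 'I_N) (p : 'rV[R]_n) : Prop :=
  forall j : 'I_N, j != i -> dot (row i L) p <= dot (row j L) p.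

Definition cell (R : realType) (N n : nat) (L : 'M[R]_(N, n)) (i : 'I_N) :
    set 'rV[R]_n :=
  [set p | simplex p /\ optimal L i p].

(* The predecessors below are the true n - 1 and n - 2 as soon as n >= 2. *)
Definition pareto_optimal (R : realType) (N n : nat) (L : 'M[R]_(N, n))
    (i : 'I_N) : Prop :=
  cell L i !=set0 /\ has_dim (cell L i) n.-1.

Definition neighboring (R : realType) (N n : nat) (L : 'M[R]_(N, n))
    (i j : 'I_N) : Prop :=
  [/\ pareto_optimal L i, pareto_optimal L j
    & has_dim (cell L i `&` cell L j) n.-2].

Definition neighborhood_action_set (R : realType) (N n : nat)
    (L : 'M[R]_(N, n)) (i j : 'I_N) : {set 'I_N} :=
  [set k | `[< cell L i `&` cell L j `<=` cell L k >]]%SET.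

(* Row 0 indicates feedback 0 and row 1 feedback 1. *)
Definition signal_matrix (R : realType) (N n : nat) (H : 'M[bool]_(N, n))
    (i : 'I_N) : 'M[R]_(2, n) :=
  \matrix_(b, l) (nat_of_bool (H i l) == b :> nat)%:R.

(* The column space of the transposed signal matrix is the row space of the
   signal matrix; <<A>> is a square matrix with the row space of A.  The sum
   is a linear span, not required to be direct. *)
Definition locally_observable (R : realType) (N n : nat) (L : 'M[R]_(N, n))
    (H : 'M[bool]_(N, n)) (i j : 'I_N) : Prop :=
  (row i L - row j L <=
     \sum_(k in neighborhood_action_set L i j) <<signal_matrix R H k>>)%MS.

Definition local_observability (R : realType) (N n : nat) (L : 'M[R]_(N, n))
    (H : 'M[bool]_(N, n)) : Prop :=
  forall i j : 'I_N, neighboring L i j -> locally_observable L H i j.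

(* Items and ranks are both indexed from 0, so the rank of
   item k under s, counted from 1, is (s^-1 k).+1.  Matrix rows are indexed by
   an enumeration of the permutations (mapping ranks to items), columns by an
   enumeration of the relevance vectors. *)

Notation relevance m := {ffun 'I_m -> bool}.

Definition nactions (m : nat) : nat := #|{: {perm 'I_m}}|.
Definition noutcomes (m : nat) : nat := #|{: relevance m}|.

Lemma nactionsE (m : nat) : nactions m = m`!.
Proof. exact: card_Sn. Qed.

Lemma noutcomesE (m : nat) : noutcomes m = (2 ^ m)%N.
Proof. by rewrite /noutcomes card_ffun card_bool card_ord. Qed.

Definition ranking (m : nat) (i : 'I_(nactions m)) : {perm 'I_m} := enum_val i.
Definition outcome (m : nat) (j : 'I_(noutcomes m)) : relevance m := enum_val j.

Definition SumLoss (R : realType) (m : nat) (s : {perm 'I_m})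
    (r : relevance m) : R :=
  \sum_(k < m) ((s^-1)%g k).+1%:R * (r k)%:R.

Definition sumloss_matrix (R : realType) (m : nat) :
    'M[R]_(nactions m, noutcomes m) :=
  \matrix_(i, j) SumLoss R (ranking i) (outcome j).

Definition top1_feedback (m : nat) (m_gt0 : (0 < m)%N) :
    'M[bool]_(nactions m, noutcomes m) :=
  \matrix_(i, j) outcome j (ranking i (Ordinal m_gt0)).

(* Main.v *)
(** The expected loss of a ranking under [p] depends only on the mean relevances
    of the items, and it is minimal exactly when the ranking lists them in
    non-increasing order.  Swapping the two last items of the identity ranking
    thus gives a neighboring action, and the common cell of this pair contains
    a distribution under which item 0 is strictly the most relevant while items
    1 and 2 are equally relevant: no other action is optimal there.  Hence every
    action of the neighborhood ranks item 0 first, and its feedback does not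
    tell the outcome "only item 1 is relevant" from "only item 2 is relevant",
    whereas the difference of the two losses does. *)
Require Import Defs.
From HB Require Import structures.
From mathcomp Require Import all_boot all_order all_algebra all_fingroup.
From mathcomp Require Import boolp classical_sets reals.
From mathcomp Require Import zify lra.

Set Implicit Arguments.
Unset Strict Implicit.
Unset Printing Implicit Defensive.

Import Order.TTheory GRing.Theory Num.Theory.

Local Open Scope classical_set_scope.
Local Open Scope ring_scope.

(** * Dot products, and dimension from a relative interior point *)

Lemma dotDr (R : realType) (n : nat) (u v w : 'rV[R]_n) :
  dot u (v + w) = dot u v + dot u w.
Proof. by rewrite /dot -big_split; apply: eq_bigr => k _; rewrite mxE mulrDr. Qed.

Lemma dotZr (R : realType) (n : nat) (a : R) (u v : 'rV[R]_n) :
  dot u (a *: v) = a * dot u v.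
Proof. by rewrite /dot mulr_sumr; apply: eq_bigr => k _; rewrite mxE mulrCA. Qed.

Lemma dotBr (R : realType) (n : nat) (u v w : 'rV[R]_n) :
  dot u (v - w) = dot u v - dot u w.
Proof. by rewrite dotDr -scaleN1r dotZr mulN1r. Qed.

Lemma dotBl (R : realType) (n : nat) (u v w : 'rV[R]_n) :
  dot (u - v) w = dot u w - dot v w.
Proof.
by rewrite /dot -sumrB; apply: eq_bigr => k _; rewrite !mxE mulrBl.
Qed.

(** [x0] acts as a relative interior point: a short step along any direction of [U] stays in [A],
    and an affine combination stretches that step to full length. *)
Lemma has_dim_relint (R : realType) (n : nat) (A : set 'rV[R]_n)
    (x0 : 'rV[R]_n) (U : 'M[R]_n) :
  (forall p, A p -> (p - x0 <= U)%MS) ->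
  A x0 ->
  (forall u : 'rV_n, (u <= U)%MS -> exists2 t, 0 < t & A (x0 + t *: u)) ->
  has_dim A (\rank U).
Proof.
move=> AU Ax0 Ustep; exists x0, U; split=> //.
apply/seteqP; split=> [y [q [x [a [Ax a1 ->]]]] | y [u uU ->]] /=.
  exists (\sum_i a i *: (x i - x0)).
    by apply: summx_sub => i _; apply/scalemx_sub/AU.
  under [in RHS]eq_bigr do rewrite scalerBr.
  by rewrite sumrB -scaler_suml a1 scale1r addrC subrK.
(* [x0 + u] is [1 - t^-1] times [x0] plus [t^-1] times [x0 + t *: u]; the first coefficient may be
   negative. *)
have [t t_gt0 At] := Ustep u uU.
exists 2, (fun i => if i == ord0 then x0 else x0 + t *: u),
  (fun i => if i == ord0 then 1 - t^-1 else t^-1); split.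
- by move=> i; case: ifP.
- by rewrite !big_ord_recl big_ord0 /= addr0 subrK.
- rewrite !big_ord_recl big_ord0 /= addr0 scalerDr scalerA mulVf ?gt_eqF//.
  by rewrite scale1r addrA -scalerDl subrK scale1r.
Qed.

Lemma small_step (R : realFieldType) (I : finType) (f g : I -> R) :
  (forall i, 0 <= f i) -> (forall i, f i = 0 -> 0 <= g i) ->
  exists2 t, 0 < t & forall i, 0 <= f i + t * g i.
Proof.
(* Division by zero gives 0, so indices with [f i = 0] add nothing to [s]; every other ratio is at
   most [s]. *)
move=> f_ge0 g_ge0; set s := \sum_i `|g i| / f i.
have s_ge0 : 0 <= s by apply: sumr_ge0 => i _; rewrite divr_ge0.
have s1_gt0 : 0 < 1 + s by rewrite ltr_pwDl.
exists (1 + s)^-1; first by rewrite invr_gt0.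
move=> i; have [fi0|fi_neq0] := eqVneq (f i) 0.
  by rewrite addr_ge0// mulr_ge0 ?g_ge0// invr_ge0 ltW.
have fi_gt0 : 0 < f i by rewrite lt_def fi_neq0 f_ge0.
have gs : `|g i| / f i <= 1 + s.
  rewrite /s (bigD1 i)//= addrCA lerDl addr_ge0//.
  by apply: sumr_ge0 => k _; rewrite divr_ge0.
have tg : (1 + s)^-1 * `|g i| <= f i.
  by rewrite mulrC ler_pdivrMr// mulrC -ler_pdivrMr.
rewrite -lerBlDr sub0r; apply: le_trans tg; apply: le_trans (ler_norm _) _.
by rewrite normrN normrM gtr0_norm// invr_gt0.
Qed.

(** * Dimensions of cells and of their intersections, for any loss matrix *)

Section Cells.
Variables (R : realType) (N n : nat) (L : 'M[R]_(N, n)).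
Implicit Types (i j k : 'I_N) (p u x : 'rV[R]_n).

(* For i = j this says that i is the only optimal action under x. *)
Definition only_optimal i j x : Prop :=
  [/\ forall l, 0 < x 0 l, \sum_l x 0 l = 1,
      dot (row i L) x = dot (row j L) x
    & forall k, k != i -> k != j -> dot (row i L) x < dot (row k L) x].

Lemma cellP i p :
  cell L i p <-> simplex p /\ forall k, dot (row i L) p <= dot (row k L) p.
Proof.
split=> -[sp op]; split=> // k.
by have [->//|/op] := eqVneq k i.
Qed.

Lemma only_optimal_cell i j x :
  only_optimal i j x -> cell L i x /\ cell L j x.
Proof.
case=> x_gt0 x1 eq_ij lt_k.
have le_k k : dot (row i L) x <= dot (row k L) x.
  have [->//|ki] := eqVneq k i; have [->|kj] := eqVneq k j; first by rewrite eq_ij.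
  exact/ltW/lt_k.
have sx : simplex x by split=> // l; apply: ltW.
by split; apply/cellP; split=> // k; rewrite -?eq_ij.
Qed.

(** Its rows are the normals of the two equations satisfied on the common cell: total mass 1 and
    equal losses. For [i = j] the second row is zero, so single cells are covered too. *)
Definition cell_mx i j : 'M[R]_(1 + 1, n) :=
  col_mx (const_mx 1) (row i L - row j L).

Lemma sub_ker_cell_mx i j u :
  (u <= kermx (cell_mx i j)^T)%MS <->
  \sum_l u 0 l = 0 /\ dot (row i L) u = dot (row j L) u.
Proof.
have E1 : (u *m (const_mx 1 : 'rV_n)^T) = (\sum_l u 0 l)%:M.
  apply/matrixP => a b; rewrite !ord1 !mxE mulr1n.
  by apply: eq_bigr => l _; rewrite !mxE mulr1.
have E2 : (u *m (row i L - row j L)^T) = (dot (row i L) u - dot (row j L) u)%:M.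
  apply/matrixP => a b; rewrite !ord1 -dotBl !mxE mulr1n.
  by apply: eq_bigr => l _; rewrite [in LHS]mxE mulrC.
rewrite (sameP sub_kermxP eqP) /cell_mx tr_col_mx mul_mx_row E1 E2 row_mx_eq0.
split=> [/andP[/eqP h1 /eqP h2]|[-> ->]]; last first.
  by rewrite subrr !raddf0 eqxx.
split; first by move/matrixP/(_ 0 0): h1; rewrite !mxE mulr1n.
by apply/eqP; rewrite -subr_eq0; move/matrixP/(_ 0 0): h2; rewrite !mxE mulr1n => ->.
Qed.

(** At [x] every other constraint is strict, so it survives a small move along the kernel of
    [cell_mx i j], whose dimension is [n] minus the rank. *)
Lemma has_dim_cellI i j x : only_optimal i j x ->
  has_dim (cell L i `&` cell L j) (n - \rank (cell_mx i j)).
Proof.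
move=> xij; have [x_gt0 x1 eq_ij lt_k] := xij; have [xi xj] := only_optimal_cell xij.
rewrite -[\rank _]mxrank_tr -mxrank_ker; apply: (@has_dim_relint _ _ _ x) => //.
  move=> p [/cellP[[_ p1] pi] /cellP[_ pj]]; apply/sub_ker_cell_mx; split.
    rewrite -[RHS](subrr 1) -{1}p1 -x1 -sumrB.
    by apply: eq_bigr => l _; rewrite !mxE.
  by rewrite !dotBr eq_ij; congr (_ - _); apply: le_anti; rewrite pi pj.
move=> u /sub_ker_cell_mx[u0 ueq].
(* [f] gathers the slacks at [x] of the positivity and optimality constraints, [g] their rates of
   change along [u]. *)
pose f (a : 'I_n + 'I_N) :=
  match a with inl l => x 0 l | inr k => dot (row k L) x - dot (row i L) x end.
pose g (a : 'I_n + 'I_N) :=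
  match a with inl l => u 0 l | inr k => dot (row k L) u - dot (row i L) u end.
have [||t t_gt0 tP] := @small_step _ _ f g.
- case=> [l|k] /=; first exact: ltW.
  by rewrite subr_ge0; move/cellP: xi => [].
- case=> [l|k] /= => [xl0|/eqP]; first by have := x_gt0 l; rewrite xl0 ltxx.
  rewrite subr_eq0 => /eqP kE.
  have [->|ki] := eqVneq k i; first by rewrite subrr.
  have [->|kj] := eqVneq k j; first by rewrite ueq subrr.
  by have := lt_k k ki kj; rewrite kE ltxx.
exists t => //.
have st : simplex (x + t *: u).
  split=> [l|]; first by rewrite !mxE; have := tP (inl l).
  under eq_bigr do rewrite !mxE.
  by rewrite big_split /= -mulr_sumr u0 mulr0 addr0.
have le_t k : dot (row i L) (x + t *: u) <= dot (row k L) (x + t *: u).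
  by have := tP (inr k); rewrite /f /g !dotDr !dotZr -subr_ge0; lra.
split; apply/cellP; split=> // k; apply: le_trans (le_t k).
by rewrite !dotDr !dotZr eq_ij ueq.
Qed.

Lemma pareto_optimal_only i x : only_optimal i i x -> pareto_optimal L i.
Proof.
move=> xi; have [xc _] := only_optimal_cell xi; split; first by exists x.
have := has_dim_cellI xi; rewrite setIid /cell_mx subrr -addsmxE addsmx0 rank_rV.
suff -> : (const_mx 1 : 'rV[R]_n) != 0 by rewrite subn1.
apply/eqP => c0; case: xi => _ + _ _.
rewrite big1 => [/eqP|l _]; first by rewrite eq_sym oner_eq0.
by move/matrixP/(_ 0 l): c0; rewrite !mxE => /eqP; rewrite oner_eq0.
Qed.

Lemma neighboring_only i j x y z : i != j ->
  only_optimal i i x -> only_optimal j j y -> only_optimal i j z ->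
  neighboring L i j.
Proof.
move=> ij xi yj zij.
split; [exact: pareto_optimal_only xi | exact: pareto_optimal_only yj |].
suff <- : (n - \rank (cell_mx i j))%N = n.-2 by apply: has_dim_cellI zij.
have [_ z1 zeq _] := zij.
have c_neq0 : (const_mx 1 : 'rV[R]_n) != 0.
  apply/eqP => c0; move: z1; rewrite big1 => [/eqP|l _]; first by rewrite eq_sym oner_eq0.
  by move/matrixP/(_ 0 l): c0; rewrite !mxE => /eqP; rewrite oner_eq0.
(* Equal rows would contradict that [j] is strictly worse than [i] under [x]. *)
have d_neq0 : row i L - row j L != 0.
  rewrite subr_eq0; apply/eqP => Lij; case: xi => _ _ _ /(_ j).
  by rewrite Lij ltxx eq_sym ij => /(_ isT isT).
rewrite /cell_mx -addsmxE mxrank_disjoint_sum ?rank_rV ?c_neq0 ?d_neq0 ?subn2//.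
apply/eqP; rewrite -submx0; apply/rV_subP => u; rewrite sub_capmx.
move=> /andP[/sub_rVP[a ->] /sub_rVP[b /esym ab]].
suff -> : a = 0 by rewrite scale0r sub0mx.
(* Pairing with [z] separates the two rows: the constant row gives 1, the loss difference 0. *)
have -> : a = b * dot (row i L - row j L) z.
  transitivity (\sum_l a * z 0 l); first by rewrite -mulr_sumr z1 mulr1.
  rewrite /dot mulr_sumr; apply: eq_bigr => l _; rewrite mulrA; congr (_ * _).
  by move/matrixP/(_ 0 l): ab; rewrite !mxE mulr1 => <-.
by rewrite dotBl zeq subrr mulr0.
Qed.

End Cells.

(** * SumLoss under perturbations of the uniform distribution *)

Lemma sum_outcome (R : realType) (m : nat) (F : relevance m -> R) :
  \sum_j F (outcome j) = \sum_r F r.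
Proof. by rewrite [RHS](reindex (@outcome m))//; apply/onW_bij/enum_val_bij. Qed.

(** Relabeling the items permutes the outcomes, so the uniform distribution does not distinguish
    rankings. *)
Lemma sum_SumLoss (R : realType) (m : nat) (s : {perm 'I_m}) :
  \sum_r SumLoss R s r = \sum_r SumLoss R (1%g : {perm 'I_m}) r.
Proof.
pose h (t : {perm 'I_m}) (r : relevance m) : relevance m := [ffun k => r (t k)].
rewrite [LHS](reindex (h (s^-1)%g)).
  apply: eq_bigr => r _; rewrite /SumLoss (reindex_inj (@perm_inj _ s)).
  by apply: eq_bigr => k _; rewrite ffunE !permK invg1 perm1.
by apply: onW_bij; exists (h s) => r; apply/ffunP => k; rewrite !ffunE ?permK ?permKV.
Qed.

Definition only_relevant (m : nat) (k : 'I_m) : relevance m := [ffun l => l == k].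

Lemma SumLoss_only_relevant (R : realType) (m : nat) (s : {perm 'I_m}) k :
  SumLoss R s (only_relevant k) = ((s^-1)%g k).+1%:R.
Proof.
rewrite /SumLoss (bigD1 k)//= ffunE eqxx mulr1 big1 ?addr0// => l lk.
by rewrite ffunE (negPf lk) mulr0.
Qed.

Lemma sum_only_relevant (R : realType) (m : nat) (w : 'I_m -> nat)
    (F : relevance m -> R) :
  \sum_r F r * (1 + \sum_k (w k)%:R * (r == only_relevant k)%:R) =
  \sum_r F r + \sum_k (w k)%:R * F (only_relevant k).
Proof.
under eq_bigr do rewrite mulrDr mulr1 mulr_sumr.
rewrite big_split /= exchange_big /=; congr (_ + _); apply: eq_bigr => k _.
rewrite (bigD1 (only_relevant k))//= eqxx mulr1 mulrC big1 ?addr0// => r rk.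
by rewrite (negPf rk) !mulr0.
Qed.

Section Weights.
Variables (R : realType) (m : nat) (w : 'I_m -> nat).

Definition weight_mass : R := (noutcomes m + \sum_k w k)%:R.

(* Full support keeps this distribution in the interior of the simplex, and
   the uniform part does not affect the comparison of the actions. *)
Definition weighted_distr : 'rV[R]_(noutcomes m) :=
  \row_j (weight_mass^-1 *
    (1 + \sum_k (w k)%:R * (outcome j == only_relevant k)%:R)).

Definition weighted_rank (s : {perm 'I_m}) : nat := \sum_k w k * (s^-1)%g k.

Lemma weight_mass_gt0 : 0 < weight_mass.
Proof. by rewrite ltr0n noutcomesE addn_gt0 expn_gt0. Qed.

(** Only the last summand depends on the action: the uniform part is the same for all rankings, and
    counting ranks from 1 instead of 0 adds the total weight. *)
Lemma dot_weighted_distr i :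
  dot (row i (sumloss_matrix R m)) weighted_distr =
  weight_mass^-1 * (\sum_r SumLoss R (1%g : {perm 'I_m}) r + (\sum_k w k)%:R
                    + (weighted_rank (ranking i))%:R).
Proof.
pose G r := SumLoss R (ranking i) r *
  (1 + \sum_k (w k)%:R * (r == only_relevant k)%:R).
transitivity (weight_mass^-1 * \sum_r G r).
  rewrite -sum_outcome mulr_sumr; apply: eq_bigr => j _.
  by rewrite /G !mxE mulrCA.
rewrite sum_only_relevant sum_SumLoss -addrA -natrD -big_split /=.
congr (_ * (_ + _)); rewrite natr_sum; apply: eq_bigr => k _.
by rewrite SumLoss_only_relevant -natrM mulnS.
Qed.

Lemma only_optimal_weighted i j :
  weighted_rank (ranking i) = weighted_rank (ranking j) ->
  (forall s, s != ranking i -> s != ranking j ->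
     (weighted_rank (ranking i) < weighted_rank s)%N) ->
  only_optimal (sumloss_matrix R m) i j weighted_distr.
Proof.
have Z_gt0 := weight_mass_gt0 => eq_ij lt_s; split.
- move=> l; rewrite mxE mulr_gt0 ?invr_gt0// ltr_pwDl// sumr_ge0// => k _.
  by rewrite -natrM ler0n.
- under eq_bigr do rewrite mxE.
  rewrite -mulr_sumr.
  rewrite (sum_outcome (fun r => 1 + \sum_k (w k)%:R * (r == only_relevant k)%:R)).
  under eq_bigr do rewrite -[1 + _]mul1r.
  rewrite (sum_only_relevant w (fun=> 1)).
  under [X in _ + X]eq_bigr do rewrite mulr1.
  by rewrite -natr_sum sumr_const -natrD mulVf ?gt_eqF.
- by rewrite !dot_weighted_distr eq_ij.
- move=> k ki kj; rewrite !dot_weighted_distr ltr_pM2l ?invr_gt0// ltrD2l ltr_nat.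
  by apply: lt_s; rewrite (inj_eq enum_val_inj).
Qed.

End Weights.

(** * Permutations of three items, in a form suited to linear arithmetic *)

Lemma perm3_neq (s : {perm 'I_3}) :
  [/\ s 0 != s 1 :> nat, s 0 != s 2 :> nat & s 1 != s 2 :> nat].
Proof. by split; rewrite (inj_eq val_inj) (inj_eq perm_inj). Qed.

Lemma ord3_cases (k : 'I_3) : [\/ k = 0, k = 1 | k = 2].
Proof.
by case: k => [[|[|[|//]]] klt];
  [constructor 1 | constructor 2 | constructor 3]; apply: val_inj.
Qed.

Lemma perm3_eq (s t : {perm 'I_3}) :
  s 0 = t 0 :> nat -> s 1 = t 1 :> nat -> s = t.
Proof.
move=> s0 s1; have s2 : s 2 = t 2 :> nat.
  have [] := (perm3_neq s, perm3_neq t).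
  have := ltn_ord (s 0); have := ltn_ord (s 1); have := ltn_ord (s 2).
  have := ltn_ord (t 2); rewrite s0 s1 => ? ? ? ? [] ? ? ? [] ? ? ?; lia.
by apply/permP => k; apply: val_inj; case: (ord3_cases k) => ->.
Qed.

Lemma weighted_rank3 (w : 'I_3 -> nat) (s : {perm 'I_3}) :
  weighted_rank w s =
  (w 0%R * (s^-1)%g 0%R + w 1%R * (s^-1)%g 1%R + w 2%R * (s^-1)%g 2%R)%N.
Proof.
rewrite /weighted_rank !big_ord_recl big_ord0 addn0 addnA.
have -> : lift ord0 ord0 = 1 :> 'I_3 by apply: val_inj.
by have -> : lift ord0 (lift ord0 ord0) = 2 :> 'I_3 by apply: val_inj.
Qed.

Definition swap_last : {perm 'I_3} := tperm (1 : 'I_3) (2 : 'I_3).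

(** * The identity ranking and the swap of its last two items *)

Section Swap.
Variables (R : realType) (i j : 'I_(nactions 3)).
Hypotheses (ranking_i : ranking i = 1%g) (ranking_j : ranking j = swap_last).

(** By the rearrangement inequality, strictly decreasing weights along a ranking make it the only
    minimizer. [w_ij] sees only the rank of item 0, so exactly the two rankings with item 0 first
    tie. *)
Let w_i (k : 'I_3) := nth 0%N [:: 2; 1; 0]%N k.
Let w_j (k : 'I_3) := nth 0%N [:: 2; 0; 1]%N k.
Let w_ij (k : 'I_3) := nth 0%N [:: 1; 0; 0]%N k.

Let tperm_ranks : [/\ (swap_last^-1)%g 0 = 0,
  (swap_last^-1)%g 1 = 2
  & (swap_last^-1)%g 2 = 1].
Proof. by rewrite /swap_last tpermV tpermL tpermR tpermD. Qed.

Let neq_id (s : {perm 'I_3}) : s != 1%g ->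
  ((s^-1)%g 0 != 0 :> nat) || ((s^-1)%g 1 != 1%N :> nat).
Proof.
apply: contraR; rewrite negb_or !negbK => /andP[/eqP s0 /eqP s1].
by apply/eqP/invg_inj/perm3_eq; rewrite invg1 perm1.
Qed.

Let neq_tperm (s : {perm 'I_3}) : s != swap_last ->
  ((s^-1)%g 0 != 0 :> nat) || ((s^-1)%g 1 != 2%N :> nat).
Proof.
apply: contraR; rewrite negb_or !negbK => /andP[/eqP s0 /eqP s1].
by have [t0 t1 _] := tperm_ranks; apply/eqP/invg_inj/perm3_eq; rewrite ?t0 ?t1.
Qed.

Let only_i : only_optimal (sumloss_matrix R 3) i i (weighted_distr R w_i).
Proof.
apply: only_optimal_weighted => // s; rewrite ranking_i => /neq_id s1 _.
have [? ? ?] := perm3_neq (s^-1)%g.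
by rewrite !weighted_rank3 invg1 !perm1 /w_i /=; lia.
Qed.

Let only_j : only_optimal (sumloss_matrix R 3) j j (weighted_distr R w_j).
Proof.
apply: only_optimal_weighted => // s; rewrite ranking_j => /neq_tperm st _.
have [? ? ?] := perm3_neq (s^-1)%g; have [t0 t1 t2] := tperm_ranks.
have := ltn_ord ((s^-1)%g 0); have := ltn_ord ((s^-1)%g 1).
have := ltn_ord ((s^-1)%g 2).
by rewrite !weighted_rank3 t0 t1 t2 /w_j /=; lia.
Qed.

Let only_ij : only_optimal (sumloss_matrix R 3) i j (weighted_distr R w_ij).
Proof.
have [t0 t1 t2] := tperm_ranks.
apply: only_optimal_weighted; rewrite ranking_i ranking_j !weighted_rank3 invg1 !perm1.
  by rewrite t0 t1 t2.
move=> s /neq_id s1 /neq_tperm st; have [? ? ?] := perm3_neq (s^-1)%g.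
have := ltn_ord ((s^-1)%g 0); have := ltn_ord ((s^-1)%g 1).
by rewrite !weighted_rank3 /w_ij /=; lia.
Qed.

Let neq_ij : i != j.
Proof.
apply/eqP => ij; have [t0 t1 _] := tperm_ranks.
by move: t1; rewrite -ranking_j -ij ranking_i invg1 perm1 => /(congr1 val).
Qed.

Lemma neighboring_swap : neighboring (sumloss_matrix R 3) i j.
Proof. exact: neighboring_only neq_ij only_i only_j only_ij. Qed.

Let in_neighborhood k :
  k \in neighborhood_action_set (sumloss_matrix R 3) i j -> ranking k 0 = 0.
Proof.
(* An action of the neighborhood is optimal under the distribution of [w_ij], hence is [i] or
   [j]. *)
rewrite inE => /asboolP/(_ _ (only_optimal_cell only_ij))/cellP[_ /(_ i) le_ki].
have [_ _ _ lt_k] := only_ij.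
have [->|ki] := eqVneq k i; first by rewrite ranking_i perm1.
have [->|kj] := eqVneq k j; first by rewrite ranking_j /swap_last tpermD.
by have := lt_le_trans (lt_k k ki kj) le_ki; rewrite ltxx.
Qed.

Lemma not_locally_observable_swap :
  ~ locally_observable (sumloss_matrix R 3) (@top1_feedback 3 isT) i j.
Proof.
pose e k : 'I_(noutcomes 3) := enum_rank (only_relevant k).
(* [v] is the separating functional: it kills every signal matrix of the neighborhood but takes the
   value -2 on the loss difference. *)
pose v : 'cV[R]_(noutcomes 3) := delta_mx (e 1) 0 - delta_mx (e 2) 0.
have vE (q : nat) (A : 'M[R]_(q, noutcomes 3)) a :
    (A *m v) a 0 = A a (e 1) - A a (e 2).
  by rewrite mulmxBr -!colE !mxE.
have outcome_e k : outcome (e k) = only_relevant k by exact: enum_rankK.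
suff sub : (\sum_(k in neighborhood_action_set (sumloss_matrix R 3) i j)
    <<signal_matrix R (@top1_feedback 3 isT) k>> <= kermx v)%MS.
  move=> /submx_trans/(_ sub)/sub_kermxP/matrixP/(_ 0 0); rewrite vE !mxE.
  rewrite !outcome_e !SumLoss_only_relevant ranking_i ranking_j.
  have [_ -> ->] := tperm_ranks; rewrite invg1 !perm1 /=.
  by move=> h; have {h} : 2 - 3 - (3 - 2) = 0 :> R := h; lra.
apply/sumsmx_subP => k /in_neighborhood k0; rewrite genmxE; apply/sub_kermxP.
apply/matrixP => b c; rewrite ord1 vE !mxE !outcome_e !ffunE.
have -> : Ordinal (isT : (0 < 3)%N) = 0 by apply: val_inj.
by rewrite k0 subrr.
Qed.

End Swap.

Theorem theorem4 (R : realType) :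
  ~ local_observability (sumloss_matrix R 3) (@top1_feedback 3 isT) /\
  exists i j : 'I_(nactions 3),
    neighboring (sumloss_matrix R 3) i j /\
    ~ locally_observable (sumloss_matrix R 3) (@top1_feedback 3 isT) i j.
Proof.
have [i ri] : exists i : 'I_(nactions 3), ranking i = 1%g.
  by exists (enum_rank 1%g); apply: enum_rankK.
have [j rj] : exists j : 'I_(nactions 3), ranking j = swap_last.
  by exists (enum_rank (swap_last)); apply: enum_rankK.
have nij := neighboring_swap R ri rj.
have oij := not_locally_observable_swap (R := R) ri rj.
split; first by move=> /(_ i j nij).
by exists i, j.
Qed.
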